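(* There does not exist a Seidel matrix $S$ with characteristic polynomial $\chi_S(x)=(x+5)^{33}(x-9)^{10}(x-11)^5(x^2-20x+95)$.
   Context: A Seidel matrix is a symmetric matrix with all diagonal entries $0$ and all off-diagonal entries $\pm1$. For a square matrix $M$, $\chi_M(x)=\det(xI-M)$. *)

(* Defs.v *)
From mathcomp Require Import all_boot all_order all_algebra.

Set Implicit Arguments.
Unset Strict Implicit.
Unset Printing Implicit Defensive.

Import GRing.Theory.
Local Open Scope ring_scope.

Definition is_seidel (n : nat) (S : 'M[int]_n) : Prop :=
  [/\ S^T = S,
      forall i : 'I_n, S i i = 0
    & forall i j : 'I_n, i != j -> S i j = 1 \/ S i j = -1].

(* Main.v *)
Require Import Defs.
From mathcomp Require Import all_boot all_order all_fingroup all_algebra all_field.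
From mathcomp Require Import zify ring.

(** Let [A = S + 5], a Gram matrix with eigenvalues [0, 14, 16, 15 ± sqrt 5], the
    last two simple, and let [N] be the part of [A] living on the two irrational
    eigenspaces. Since all entries of [A] are odd, [4 * N = A (A - 14) (A - 16)] has
    all its entries divisible by 4, so [N] is an integer matrix of rank 2 and trace
    30. Positivity of the parts of [A] on the eigenvalues 14 and 16 bounds the
    diagonal entries [n_i] of [N] and [t_i] of [E = N^2 - 15 N]: one gets
    [n_i - 6 <= t_i <= 4 - n_i]. Moreover [t_i] and [n_i] have the same parity, and
    the [t_i] sum to 10. An index with [t_i > 0] has [(n_i, t_i)] equal to (1,1),
    (2,2) or (3,1). As the two irrational eigenspaces are lines, row [i] of [N] and
    row [i] of [E] determine all [n_k] and [t_k] through quadratic equations, whose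
    integer solutions are too few to be compatible with the norms and the scalar
    product of these two rows. *)

Set Implicit Arguments.
Unset Strict Implicit.
Unset Printing Implicit Defensive.

Import Order.TTheory GRing.Theory Num.Theory.
Local Open Scope ring_scope.

(** * Integer solutions of the row equations *)

(** Case [(3,1)] of the pair [(N i i, E i i)]: [x], [u] stand for [N i k], [E i k], and [n], [t] for
    [N k k], [E k k]. The bounds force [n <= 5], hence [5x^2 + u^2 <= 74], which leaves finitely
    many [x], [u] to check. *)
Lemma sqr_le_of_diag31 (n t x u : int) : 0 <= n -> n + t <= 4 -> n - 6 <= t ->
  5 * x ^+ 2 + u ^+ 2 = 15 * n + t -> 2 * (x * u) = n + 3 * t -> u ^+ 2 <= x ^+ 2.
Proof.
rewrite !expr2 => n0 h1 h2 e1 e2.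
have hx : -3 <= x <= 3 by nia.
have hu : -9 <= u <= 9 by nia.
have : x = -3 \/ x = -2 \/ x = -1 \/ x = 0 \/ x = 1 \/ x = 2 \/ x = 3 by lia.
have : u = -9 \/ u = -8 \/ u = -7 \/ u = -6 \/ u = -5 \/ u = -4 \/ u = -3 \/
  u = -2 \/ u = -1 \/ u = 0 \/ u = 1 \/ u = 2 \/ u = 3 \/ u = 4 \/ u = 5 \/
  u = 6 \/ u = 7 \/ u = 8 \/ u = 9 by lia.
by move=> hU hX; do ![case: hU => hU]; subst u;
 do ![case: hX => hX]; subst x; lia.
Qed.

(** Case [(1,1)]. Subtracting the equations gives [4n = 4x^2 + (u - x)^2], so [u = x + 2y]; then
    [xy > 0] would give [xu >= 3], against [2xu <= 4]. *)
Lemma mul_le_sqr_of_diag11 (n t x u : int) : n + t <= 4 ->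
  5 * x ^+ 2 + u ^+ 2 = 5 * n + t -> 2 * (x * u) = n + t -> x * u <= x ^+ 2.
Proof.
rewrite !expr2 => h e1 e2.
have h4 : 4 * n = 4 * (x * x) + (u - x) * (u - x) by lia.
have [y [hy|hy]] : exists y, u - x = 2 * y \/ u - x = 2 * y + 1.
  exists ((u - x) %/ 2)%Z; lia.
  have hu : u = x + 2 * y by lia.
  by subst u; nia.
rewrite hy in h4; lia.
Qed.

(** Case [(2,2)]. Again [u = x + 2y]. Now [xu = n + t] is even, so [x] is even too, and [xy > 0]
    would give [xu >= 8], against [xu <= 4]. *)
Lemma mul_le_sqr_of_diag22 (n t x u : int) : n + t <= 4 -> (2 %| t - n)%Z ->
  5 * x ^+ 2 + u ^+ 2 = 10 * n + 2 * t -> 2 * (x * u) = 2 * n + 2 * t ->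
  x * u <= x ^+ 2.
Proof.
rewrite !expr2 => h /dvdzP [q hq] e1 e2.
have h4 : 8 * n = 4 * (x * x) + (u - x) * (u - x) by lia.
have [y [hy|hy]] : exists y, u - x = 2 * y \/ u - x = 2 * y + 1.
  exists ((u - x) %/ 2)%Z; lia.
  have hu : u = x + 2 * y by lia.
  subst u.
  have [z [hz|hz]] : exists z, x = 2 * z \/ x = 2 * z + 1.
    exists (x %/ 2)%Z; lia.
    by subst x; nia.
  by subst x; lia.
rewrite hy in h4; lia.
Qed.

Lemma sym_mulmx_diag n (X Y : 'M[int]_n) i : Y^T = Y ->
  (X *m Y) i i = \sum_k X i k * Y i k.
Proof.
by move=> hY; rewrite mxE; apply: eq_bigr => k _; rewrite -[in LHS]hY mxE.
Qed.

Lemma shifted_diag_le0 n (N : 'M[int]_n) (E := N *m N - 15 *: N) :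
  N^T = N -> N *m N *m N = 30 *: (N *m N) - 220 *: N ->
  (forall i k, 5 * N i k ^+ 2 + E i k ^+ 2 = 5 * N i i * N k k + E i i * E k k) ->
  (forall i k, 2 * (N i k * E i k) = N i i * E k k + E i i * N k k) ->
  (forall i, 0 <= N i i) -> (forall i, E i i ^+ 2 <= 5 * N i i ^+ 2) ->
  (forall i, N i i + E i i <= 4) -> (forall i, N i i - 6 <= E i i) ->
  (forall i, 2 %| E i i - N i i)%Z ->
  forall i, E i i <= 0.
Proof.
move=> symN N3 hq hl n0 hd hz hw hp i; rewrite leNgt; apply/negP => ti.
have symE : E^T = E by rewrite /E linearB linearZ /= trmx_mul symN.
have NN : N *m N = E + 15 *: N by rewrite subrK.
(* The cubic relation reduces all products of [N] and [E] to combinations of both; their diagonals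
   give the norms and the scalar product of the two rows [i]. *)
have NE : N *m E = 15 *: E + 5 *: N.
  rewrite /E mulmxBr mulmxA N3 -scalemxAr; apply/matrixP => j k; move: (N *m N) => NN'.
  by rewrite !mxE; ring.
have EE : E *m E = 5 *: (N *m N).
  rewrite {1}/E mulmxBl -mulmxA NE mulmxDr -!scalemxAr -!scalemxAl NE.
  by apply/matrixP => j k; move: (N *m N) => NN'; rewrite !mxE; ring.
have s1 : \sum_k N i k ^+ 2 = E i i + 15 * N i i.
  have := sym_mulmx_diag N i symN; rewrite NN !mxE => ->.
  by apply: eq_bigr => k _; rewrite expr2.
have s2 : \sum_k N i k * E i k = 15 * E i i + 5 * N i i.
  by rewrite -(sym_mulmx_diag N i symE) NE -!/E !mxE.
have s3 : \sum_k E i k ^+ 2 = 5 * (E i i + 15 * N i i).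
  have := sym_mulmx_diag E i symE; rewrite EE NN -/E !mxE => ->.
  by apply: eq_bigr => k _; rewrite expr2.
clearbody E.
(* With [0 < E i i <= 4 - N i i], the bound [E i i ^+ 2 <= 5 * N i i ^+ 2] and the common parity
   leave only these pairs. *)
have : (N i i = 1 /\ E i i = 1) \/ (N i i = 2 /\ E i i = 2) \/ (N i i = 3 /\ E i i = 1).
  by move: (n0 i) (hd i) (hz i) (hw i) (hp i); rewrite !expr2; nia.
(* This conclusion reads [20 <= 16] for [(1,1)] and [40 <= 32] for [(2,2)]; that of [suff2] reads
   [230 <= 46] for [(3,1)]. *)
have suff1 : (forall k, N i k * E i k <= N i k ^+ 2) ->
   15 * E i i + 5 * N i i <= E i i + 15 * N i i.
  by move=> h; rewrite -s1 -s2; apply: ler_sum.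
have suff2 : (forall k, E i k ^+ 2 <= N i k ^+ 2) ->
   5 * (E i i + 15 * N i i) <= E i i + 15 * N i i.
  by move=> h; rewrite -s3 -s1; apply: ler_sum.
case=> [[n1 t1] | [[n1 t1] | [n1 t1]]].
- suff/suff1: (forall k, N i k * E i k <= N i k ^+ 2) by lia.
  move=> k; move: (hq i k) (hl i k); rewrite n1 t1 => *.
  by apply: (mul_le_sqr_of_diag11 (hz k)); lia.
- suff/suff1: (forall k, N i k * E i k <= N i k ^+ 2) by lia.
  move=> k; move: (hq i k) (hl i k); rewrite n1 t1 => *.
  by apply: (mul_le_sqr_of_diag22 (hz k) (hp k)); lia.
- suff/suff2: (forall k, E i k ^+ 2 <= N i k ^+ 2) by lia.
  move=> k; move: (hq i k) (hl i k); rewrite n1 t1 => *.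
  by apply: (sqr_le_of_diag31 (n0 k) (hz k) (hw k)); lia.
Qed.

(** * Divisibility of the cubic in [A] by 4 *)

Lemma sum_sym_even n (X : 'M[int]_n) : X^T = X -> (forall i, 2 %| X i i)%Z ->
  (2 %| \sum_i \sum_j X i j)%Z.
Proof.
move=> symX hX.
have -> : \sum_i \sum_j X i j =
    \sum_i X i i + 2 * \sum_(i < n) \sum_(j < n | (j < i)%N) X i j.
  rewrite mulr_natl mulr2n addrA.
  rewrite [X in _ = _ + X](exchange_big_dep xpredT) //= -!big_split /=.
  apply: eq_bigr => i _; rewrite (bigD1 i) //= -addrA; congr (_ + _).
  rewrite (bigID (fun j : 'I_n => (j < i)%N)) /=; congr (_ + _).
    by apply: eq_bigl => j; rewrite -val_eqE /=; lia.
  rewrite (eq_bigl (fun j : 'I_n => (i < j)%N)); last first.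
    by move=> j; rewrite -val_eqE /=; lia.
  by apply: eq_bigr => j _; rewrite -[in LHS]symX mxE.
by rewrite rpredD ?rpred_sum // dvdz_mulr.
Qed.

(* Write [A = J + 2 X] with [J] the all-ones matrix: as [J^2 = 50 J], the only term
   not visibly divisible by 4 is [2 J X J], and the sum of the entries of [X] is even. *)
Lemma gram_cubic_dvd4 n (A : 'M[int]_n) : n = 50%N -> A^T = A ->
  (forall i, A i i = 5) -> (forall i j, ~~ (2 %| A i j)%Z) ->
  exists N : 'M[int]_n, A *m A *m A - 30 *: (A *m A) + 224 *: A = 4 *: N.
Proof.
move=> n50 symA diagA oddA; pose J : 'M[int]_n := const_mx 1.
pose X : 'M[int]_n := \matrix_(i, j) ((A i j) %/ 2)%Z.
have AE : A = J + 2 *: X.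
  by apply/matrixP => i j; rewrite !mxE; have := oddA i j; lia.
have symX : X^T = X by apply/matrixP=> i j; rewrite !mxE -{1}symA mxE.
(* The diagonal entries of [X] are all 2, the integer half of 5. *)
have /dvdzP[c hc] : (2 %| \sum_i \sum_j X i j)%Z.
  by apply: sum_sym_even => // i; rewrite mxE diagA.
have JJ : J *m J = 50 *: J.
  apply/matrixP => i j; rewrite !mxE (eq_bigr (fun=> 1)) => [|k _]; last first.
    by rewrite !mxE.
  by rewrite sumr_const card_ord n50.
have JXJ : J *m X *m J = (2 * c) *: J.
  apply/matrixP => i j; rewrite !mxE mulr1 mulrC -hc exchange_big.
  apply: eq_bigr => k _.
  by rewrite !mxE mulr1; apply: eq_bigr => l _; rewrite !mxE mul1r.
have A2 : A *m A = 50 *: J + 2 *: (J *m X) + 2 *: (X *m J) + 4 *: (X *m X).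
  rewrite AE !(mulmxDl, mulmxDr) -!(scalemxAl, scalemxAr) JJ.
  move: (J *m X) (X *m J) (X *m X) => *; apply/matrixP => i j; rewrite !mxE; ring.
have A3 : A *m A *m A = 2500 *: J + 100 *: (J *m X) + (4 * c) *: J + 4 *: (J *m X *m X)
    + 100 *: (X *m J) + 4 *: (X *m J *m X) + 4 *: (X *m X *m J) + 8 *: (X *m X *m X).
  rewrite A2 AE !(mulmxDl, mulmxDr) -!(scalemxAl, scalemxAr) JJ JXJ.
  rewrite -(mulmxA X J J) JJ -scalemxAr.
  move: (J *m X *m X) (X *m J *m X) (X *m X *m J) (X *m X *m X) (J *m X) (X *m J) => *.
  apply/matrixP => i j; rewrite !mxE; ring.
(* A quarter of the expanded cubic; for instance [306 = (2500 - 30 * 50 + 224) / 4]. *)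
exists (306 *: J + c *: J + 10 *: (J *m X) + 10 *: (X *m J) + J *m X *m X + X *m J *m X
  + X *m X *m J + 2 *: (X *m X *m X) - 30 *: (X *m X) + 112 *: X).
rewrite A3 A2 AE.
move: (J *m X *m X) (X *m J *m X) (X *m X *m J) (X *m X *m X).
move: (X *m X) (J *m X) (X *m J) => *; apply/matrixP => i j; rewrite !mxE; ring.
Qed.

(** * Functional calculus in a unitary eigenbasis *)

Lemma char_poly_conj (R : comUnitRingType) n (P B : 'M[R]_n) :
  P \in unitmx -> char_poly (invmx P *m B *m P) = char_poly B.
Proof.
move=> uP; rewrite /char_poly /char_poly_mx.
have PK : map_mx polyC (invmx P) *m map_mx polyC P = 1%:M.
  by rewrite -map_mxM mulVmx // map_mx1.
have -> : 'X%:M - map_mx polyC (invmx P *m B *m P) =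
    map_mx polyC (invmx P) *m ('X%:M - map_mx polyC B) *m map_mx polyC P.
  by rewrite mulmxBr mulmxBl mul_mx_scalar -scalemxAl PK scalemx1 -!map_mxM.
by rewrite !det_mulmx mulrAC -det_mulmx PK det1 mul1r.
Qed.

(** The matrix with eigenvalues [f] in the orthonormal basis of conjugated rows of [P]. Matrix
    identities become pointwise identities between eigenvalue functions, and the entrywise form
    shows the rank one pieces. *)
Definition spec_mx n (P : 'M[algC]_n) (f : 'I_n -> algC) : 'M[algC]_n :=
  \matrix_(i, k) \sum_j f j * ((P j i)^* * P j k).

Section SpecMx.
Variables (n : nat) (P : 'M[algC]_n).
Hypothesis uP : P \is unitarymx.
Implicit Types f g : 'I_n -> algC.

Lemma spec_mxE f : spec_mx P f = invmx P *m diag_mx (\row_j f j) *m P.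
Proof.
rewrite invmx_unitary //; apply/matrixP => i k; rewrite !mxE; apply: eq_bigr => j _.
by rewrite mul_mx_diag !mxE; ring.
Qed.

Lemma eq_spec_mx f g : f =1 g -> spec_mx P f = spec_mx P g.
Proof.
by move=> fg; apply/matrixP => i k; rewrite !mxE; apply: eq_bigr => j _; rewrite fg.
Qed.

Lemma spec_mxM f g : spec_mx P f *m spec_mx P g = spec_mx P (fun j => f j * g j).
Proof.
rewrite !spec_mxE !mulmxA mulmxK ?unitarymx_unit // -!mulmxA; congr (_ *m _).
rewrite !mulmxA mulmx_diag; congr (diag_mx _ *m _); by apply/rowP => j; rewrite !mxE.
Qed.

Lemma spec_mxD f g : spec_mx P f + spec_mx P g = spec_mx P (fun j => f j + g j).
Proof.
by apply/matrixP => i k; rewrite !mxE -big_split; apply: eq_bigr => j _; rewrite mulrDl.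
Qed.

Lemma spec_mxZ c f : c *: spec_mx P f = spec_mx P (fun j => c * f j).
Proof.
by apply/matrixP => i k; rewrite !mxE mulr_sumr; apply: eq_bigr => j _; rewrite mulrA.
Qed.

Lemma spec_mx_const c : spec_mx P (fun=> c) = c%:M.
Proof.
rewrite spec_mxE (_ : diag_mx _ = c%:M); last by apply/matrixP => i j; rewrite !mxE.
by rewrite mul_mx_scalar -scalemxAl mulVmx ?unitarymx_unit // scalemx1.
Qed.

Lemma spec_mx_trace f : \tr (spec_mx P f) = \sum_j f j.
Proof.
rewrite spec_mxE mxtrace_mulC mulmxA mulmxV ?unitarymx_unit // mul1mx mxtrace_diag.
by apply: eq_bigr => j _; rewrite mxE.
Qed.

Lemma spec_mx_ge0 f i : (forall j, 0 <= f j) -> 0 <= spec_mx P f i i.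
Proof.
move=> f0; rewrite mxE; apply: sumr_ge0 => j _.
by rewrite mulr_ge0 // mulrC mul_conjC_ge0.
Qed.

Lemma spec_mx_char_poly f : char_poly (spec_mx P f) = \prod_j ('X - (f j)%:P).
Proof.
rewrite spec_mxE char_poly_conj ?unitarymx_unit // char_poly_trig ?diag_mx_is_trig //.
by apply: eq_bigr => j _; rewrite !mxE eqxx.
Qed.
End SpecMx.

Lemma sym_int_spec_mx n (S : 'M[int]_n) : S^T = S ->
  exists2 P : 'M[algC]_n, P \is unitarymx & exists d, map_mx intr S = spec_mx P d.
Proof.
move=> symS; set SC : 'M[algC]_n := map_mx intr S.
have /orthomx_spectralP SE : SC \is normalmx.
  apply: symmetric_normalmx.
    by apply/is_hermitianmxP; rewrite expr0 scale1r map_mx_id // map_trmx symS.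
  by apply/mxOverP => i j; rewrite mxE; apply/realz.
exists (spectralmx SC); first exact: spectral_unitarymx.
exists (fun j => spectral_diag SC 0 j); rewrite spec_mxE ?spectral_unitarymx // [LHS]SE.
by congr (_ *m diag_mx _ *m _); apply/rowP => j; rewrite mxE.
Qed.

(** Unique factorisation into linear factors matches the two lists; the permutation allows a given
    root to be located by its position in [s]. *)
Lemma spec_mx_eigenvalues n (P : 'M[algC]_n) d (s : seq algC) : P \is unitarymx ->
  char_poly (spec_mx P d) = \prod_(x <- s) ('X - x%:P) ->
  size s = n /\ exists p : 'S_n, forall j, d j = nth 0 s (p j).
Proof.
move=> uP; rewrite spec_mx_char_poly // => hp.
have ps : perm_eq [tuple d j | j < n] s.
  by apply: prod_XsubC_eq; rewrite -hp big_map big_enum.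
have szs : size s = n by rewrite -(perm_size ps) size_tuple.
split=> //; have [p hE] := tuple_permP (t := Tuple (introT eqP szs)) ps.
exists p => j; have /(congr1 (fun t => nth 0 t j)) := hE.
by rewrite -!tnth_nth !tnth_mktuple (tnth_nth 0).
Qed.

(** * Spectrum of [S + 5] *)

Lemma gram_spectrum n (S : 'M[int]_n) : S^T = S ->
  char_poly S = ('X + 5%:P) ^+ 33 * ('X - 9%:P) ^+ 10 * ('X - 11%:P) ^+ 5
          * ('X^2 - 20%:P * 'X + 95%:P) ->
  n = 50%N /\ exists (P : 'M[algC]_n) (d : 'I_n -> algC) (j1 j2 : 'I_n),
  [/\ P \is unitarymx, map_mx intr (S + 5%:M) = spec_mx P d,
   [/\ j1 != j2, d j1 = 15 + sqrtC 5 & d j2 = 15 - sqrtC 5] &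
   forall j, j != j1 -> j != j2 -> [\/ d j = 0, d j = 14 | d j = 16]].
Proof.
move=> symS hchar; have [P uP [f SE]] := sym_int_spec_mx symS.
set r : algC := sqrtC 5; have r2 : r ^+ 2 = 5 by rewrite sqrtCK.
have mC (k : nat) : map_poly (intr : int -> algC) k%:R%:P = k%:R%:P.
  by rewrite map_polyC /= rmorph_nat.
have mX (k : nat) : map_poly (intr : int -> algC) ('X - k%:R%:P) = 'X - k%:R%:P.
  by rewrite rmorphB /= map_polyX mC.
have mX5 : map_poly (intr : int -> algC) ('X + 5%:R%:P) = 'X - (-5)%:P.
  by rewrite rmorphD /= map_polyX (mC 5%N) polyCN opprK.
have mq : map_poly (intr : int -> algC) ('X^2 - 20%:P * 'X + 95%:P) =
    ('X - (10 + r)%:P) * ('X - (10 - r)%:P).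
  transitivity ('X^2 - 20%:R%:P * 'X + 95%:R%:P : {poly algC}).
    rewrite rmorphD rmorphB /= [map_poly _ 'X^2]rmorphXn rmorphM /=.
    by rewrite map_polyX (mC 20%N) (mC 95%N).
  have h : r%:P ^+ 2 = 5%:R :> {poly algC} by rewrite -rmorphXn r2 rmorph_nat.
  by rewrite polyCB (polyCD 10) !polyC_natr; ring: h.
(* The two simple irrational roots come first, so that [j1] and [j2] are the preimages of positions
   0 and 1. *)
pose s := [:: 10 + r, 10 - r & nseq 33 (-5) ++ nseq 10 9 ++ nseq 5 11].
have hs : char_poly (spec_mx P f) = \prod_(x <- s) ('X - x%:P).
  rewrite /s 2!big_cons 2!big_cat 3!big_nseq 3!iter_mulr_1 -SE -map_char_poly hchar.
  rewrite 3!rmorphM 3!rmorphXn /= mX5 (mX 9%N) (mX 11%N) mq.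
  set a := _ ^+ 33; set b := _ ^+ 10; set c := _ ^+ 5.
  by rewrite [RHS]mulrA [RHS]mulrC (mulrA a b c).
have [szs [p fE]] := spec_mx_eigenvalues uP hs.
have n50 : n = 50%N by rewrite -szs.
split=> //.
have h0 : (0 < n)%N by rewrite n50.
have h1 : (1 < n)%N by rewrite n50.
exists P, (fun j => f j + 5), ((p^-1)%g (Ordinal h0)), ((p^-1)%g (Ordinal h1)).
split=> //.
- rewrite raddfD /= map_scalar_mx SE rmorph_nat -(spec_mx_const uP) spec_mxD //.
- split; rewrite ?fE ?permKV /=; [|ring|ring].
  by rewrite (inj_eq perm_inj).
have pE j a : (j != (p^-1)%g a) = (p j != a)
  by congr (~~ _); apply/eqP/eqP => [-> | <-]; rewrite ?permKV ?permK.
move=> j; rewrite fE !pE.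
case: (p j) => [[|[|k]] hk] // _ _.
rewrite -[nth _ _ _]/(nth 0 (nseq 33 (-5) ++ nseq 10 9 ++ nseq 5 11) k).
have {}hk : (k < 48)%N by lia.
rewrite nth_cat size_nseq nth_nseq; case: ltnP => ?; first by constructor 1; ring.
rewrite nth_cat size_nseq nth_nseq; case: ltnP => ?; first by constructor 2; ring.
by rewrite nth_nseq ifT; [constructor 3; ring | lia].
Qed.

(** * The integer matrix [N] carried by the two irrational eigenlines *)

Local Notation toC := (map_mx (intr : int -> algC)).

Lemma toC_inj n : injective (toC : 'M[int]_n -> 'M[algC]_n).
Proof.
move=> X Y /matrixP XY; apply/matrixP => i j; have := XY i j.
by rewrite !mxE => /intr_inj.
Qed.

Lemma sum_support2 (I : finType) (f g : I -> algC) (j1 j2 : I) : j1 != j2 ->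
  (forall j, j != j1 -> j != j2 -> f j = 0) ->
  \sum_j f j * g j = f j1 * g j1 + f j2 * g j2.
Proof.
move=> j12 f0; rewrite (bigD1 j1) // (bigD1 j2) 1?eq_sym //= big1 ?addr0 //.
move=> j /andP[h1 h2].
by rewrite f0 ?mul0r.
Qed.

(* Pairs of an eigenvalue of [A] and of the corresponding eigenvalue of [N]. *)
Variant irrpart_eigen : algC -> algC -> Prop :=
| IrrPlus : irrpart_eigen (15 + sqrtC 5) (15 + sqrtC 5)
| IrrMinus : irrpart_eigen (15 - sqrtC 5) (15 - sqrtC 5)
| Irr0 : irrpart_eigen 0 0
| Irr14 : irrpart_eigen 14 0
| Irr16 : irrpart_eigen 16 0.

Section IrrationalPart.
Variables (n : nat) (A N : 'M[int]_n) (P : 'M[algC]_n) (d : 'I_n -> algC).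
Variables (j1 j2 : 'I_n).
Let r : algC := sqrtC 5.
Hypotheses (symA : A^T = A) (uP : P \is unitarymx) (AP : toC A = spec_mx P d).
Hypotheses (j12 : j1 != j2) (d1 : d j1 = 15 + r) (d2 : d j2 = 15 - r).
Hypothesis d0 : forall j, j != j1 -> j != j2 -> [\/ d j = 0, d j = 14 | d j = 16].
Hypothesis NA : A *m A *m A - 30 *: (A *m A) + 224 *: A = 4 *: N.

Let E := N *m N - 15 *: N.
Let r2 : r * r = 5. Proof. by rewrite -expr2 sqrtCK. Qed.
Let nu j := if (j == j1) || (j == j2) then d j else 0.

Lemma irrpart_sym : N^T = N.
Proof.
have : 4 *: N^T = 4 *: N.
  have := congr1 trmx NA; rewrite !(linearB, linearD, linearZ) /=.
  rewrite !trmx_mul symA mulmxA => <-.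
  by rewrite scalerN NA.
move/matrixP => h; apply/matrixP => i j; have := h i j.
by rewrite !mxE => /(mulfI _); exact.
Qed.

Let eigP j : irrpart_eigen (d j) (nu j).
Proof.
rewrite /nu; case: (eqVneq j j1) => [-> | h1]; first by rewrite d1; constructor.
case: (eqVneq j j2) => [-> | h2]; first by rewrite d2; constructor.
by case: (d0 h1 h2) => ->; constructor.
Qed.

(** The polynomial [x (x - 14) (x - 16)] kills 0, 14 and 16, while at [x = 15 ± sqrt 5] its last two
    factors multiply to [(x - 15)^2 - 1 = 4]. *)
Let NP : toC N = spec_mx P nu.
Proof.
have /(congr1 toC) := NA.
rewrite !(map_mxD, map_mxN, map_mxZ, map_mxM) /= AP -scaleNr.
rewrite !(spec_mxM uP, spec_mxZ, spec_mxD) => h.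
have -> : toC N = 4^-1 *: (4 *: toC N) by rewrite scalerA mulVf ?scale1r // pnatr_eq0.
have -> : 4 *: toC N = (4 : int)%:~R *: toC N by rewrite rmorph_nat.
rewrite -h spec_mxZ; apply: eq_spec_mx => j.
by case: eigP; rewrite -/r !rmorph_nat; field: r2.
Qed.

(** Entries of the orthogonal projection onto the [j]-th eigenline. *)
Let coef j i k := (P j i)^* * P j k.

Let NE i k : ((N i k)%:~R : algC) = (15 + r) * coef j1 i k + (15 - r) * coef j2 i k.
Proof.
have /matrixP/(_ i k) := NP; rewrite !mxE => ->.
rewrite (sum_support2 _ j12) /nu ?eqxx ?orbT ?d1 ?d2 // => j /negPf-> /negPf->; by [].
Qed.

Let EP : toC E = spec_mx P (fun j => nu j * nu j - 15 * nu j).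
Proof.
rewrite /E map_mxB map_mxZ map_mxM NP spec_mxM // -scaleNr spec_mxZ spec_mxD.
by apply: eq_spec_mx => j; rewrite rmorph_nat mulNr.
Qed.

(** An eigenvalue [x = 15 ± sqrt 5] of [N] becomes [x (x - 15) = ± sqrt 5 * x]: if [N] is the sum
    [a + b] of its two parts, then [E = r (a - b)]. *)
Let EE i k : ((E i k)%:~R : algC) =
  r * ((15 + r) * coef j1 i k - (15 - r) * coef j2 i k).
Proof.
have /matrixP/(_ i k) := EP; rewrite [LHS]mxE => ->; rewrite mxE.
rewrite (sum_support2 _ j12) /nu ?eqxx ?orbT ?d1 ?d2; last first.
  by move=> j /negPf-> /negPf-> /=; ring.
rewrite /= -/(coef j1 i k) -/(coef j2 i k); ring: r2.
Qed.

Let A_spec2 : toC (A *m A) = spec_mx P (fun j => d j * d j).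
Proof. by rewrite map_mxM AP spec_mxM. Qed.

Let N_spec2 : toC (N *m N) = spec_mx P (fun j => nu j * nu j).
Proof. by rewrite map_mxM NP spec_mxM. Qed.

Lemma irrpart_mul_gram : N *m A = N *m N.
Proof.
apply: toC_inj; rewrite map_mxM NP AP N_spec2 spec_mxM //; apply: eq_spec_mx => j.
by case: eigP; ring.
Qed.

(** The numbers [15 ± sqrt 5] have sum 30 and product 220. *)
Lemma irrpart_cubic : N *m N *m N = 30 *: (N *m N) - 220 *: N.
Proof.
apply: toC_inj; rewrite map_mxM map_mxB !map_mxZ N_spec2 NP -scaleNr.
rewrite !(spec_mxM uP, spec_mxZ, spec_mxD).
by apply: eq_spec_mx => j; case: eigP; rewrite -/r !rmorph_nat; ring: r2.
Qed.

Lemma irrpart_trace : \tr N = 30.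
Proof.
apply/(@intr_inj algC); rewrite -[LHS]trace_map_mx NP spec_mx_trace //.
rewrite (eq_bigr (fun j => nu j * 1)) => [|j _]; last by rewrite mulr1.
rewrite (sum_support2 _ j12) /nu ?eqxx ?orbT ?d1 ?d2 ?rmorph_nat /=; first by ring.
by move=> j /negPf-> /negPf->.
Qed.

Lemma irrpart_trace2 : \tr E = 10.
Proof.
apply/(@intr_inj algC); rewrite -[LHS]trace_map_mx EP spec_mx_trace //.
rewrite (eq_bigr (fun j => (nu j * nu j - 15 * nu j) * 1)); last first.
  by move=> j _; rewrite mulr1.
rewrite (sum_support2 _ j12) /nu ?eqxx ?orbT ?d1 ?d2 ?rmorph_nat /=; first by ring: r2.
by move=> j /negPf-> /negPf-> /=; ring.
Qed.

Let r_ge0 : 0 <= r. Proof. by rewrite sqrtC_ge0 ler0n. Qed.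
Let r_le15 : 0 <= 15 - r.
Proof.
rewrite subr_ge0 -(@ler_pXn2r _ 2) ?nnegrE ?ler0n // sqrtCK -natrX ler_nat //.
Qed.
Let rp : 0 <= 15 + r. Proof. by rewrite addr_ge0 ?ler0n. Qed.

Let coef_ge0 j i : 0 <= coef j i i.
Proof. by rewrite /coef mulrC mul_conjC_ge0. Qed.

Lemma irrpart_diag_ge0 i : 0 <= N i i.
Proof. by rewrite -(ler0z algC) NE; apply: addr_ge0; apply: mulr_ge0. Qed.

(** In terms of the two nonnegative parts, [5 (a + b)^2 - 5 (a - b)^2 = 20 a b]. *)
Lemma irrpart_diag_det i : E i i ^+ 2 <= 5 * N i i ^+ 2.
Proof.
rewrite -(ler_int algC) -subr_ge0 [(5 * _)%:~R]rmorphM !rmorphXn /= NE EE rmorph_nat.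
have -> : 5 * ((15 + r) * coef j1 i i + (15 - r) * coef j2 i i) ^+ 2 -
   (r * ((15 + r) * coef j1 i i - (15 - r) * coef j2 i i)) ^+ 2 =
   20 * (((15 + r) * coef j1 i i) * ((15 - r) * coef j2 i i)).
  rewrite exprMn [r ^+ 2]expr2 r2; ring.
by apply: mulr_ge0; [rewrite ler0n | apply: mulr_ge0; apply: mulr_ge0].
Qed.

Let symE : E^T = E.
Proof. by rewrite /E linearB linearZ /= trmx_mul irrpart_sym. Qed.

Let r_neq0 : r != 0. Proof. by rewrite sqrtC_eq0 pnatr_eq0. Qed.

(** The projections are a priori only Hermitian. Since [r] is nonzero, [a + b] and [r (a - b)]
    determine [a] and [b], so both parts inherit the symmetry of [N] and [E]. *)
Let coef_sym i k : (15 + r) * coef j1 i k = (15 + r) * coef j1 k i /\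
  (15 - r) * coef j2 i k = (15 - r) * coef j2 k i.
Proof.
have h1 := NE i k; have h2 := EE i k.
rewrite -irrpart_sym mxE NE in h1; rewrite -symE mxE EE in h2.
have {}h2 := mulfI r_neq0 h2.
move: h1 h2; set a := (15 + r) * _; set b := (15 - r) * _.
set c := (15 + r) * _; set e := (15 - r) * _ => h1 h2.
split; apply/(mulfI (x := 2)); rewrite ?pnatr_eq0 //.
  have -> : 2 * c = (c + e) + (c - e) by ring.
  rewrite -h1 -h2; ring.
have -> : 2 * e = (c + e) - (c - e) by ring.
rewrite -h1 -h2; ring.
Qed.

Let coef_rank1 i k : ((15 + r) * coef j1 i k) ^+ 2 =
    (15 + r) * coef j1 i i * ((15 + r) * coef j1 k k) /\
  ((15 - r) * coef j2 i k) ^+ 2 = (15 - r) * coef j2 i i * ((15 - r) * coef j2 k k).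
Proof.
have [h1 h2] := coef_sym i k.
by split; rewrite expr2; [rewrite {2}h1 | rewrite {2}h2]; rewrite /coef; ring.
Qed.

(** Both sides equal [10 (a^2 + b^2)], where [a], [b] are the [(i, k)] entries of the two parts, by
    [coef_rank1]. *)
Lemma irrpart_sqr i k :
  5 * N i k ^+ 2 + E i k ^+ 2 = 5 * N i i * N k k + E i i * E k k.
Proof.
have h5 : (5 : int)%:~R = 5 :> algC by rewrite rmorph_nat.
apply: (@intr_inj algC); move: (5 : int) h5 => c h5.
rewrite !expr2 !(intrD, intrM) !NE !EE h5.
have [] := coef_rank1 i k; rewrite !expr2.
move: ((15 + r) * coef j1 i k) ((15 - r) * coef j2 i k) => a b.
move: (_ * coef j1 i i) (_ * coef j1 k k) => a1 a2.
move: (_ * coef j2 i i) (_ * coef j2 k k) => b1 b2 h1 h2.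
ring: h1 h2 r2.
Qed.

Lemma irrpart_mul i k : 2 * (N i k * E i k) = N i i * E k k + E i i * N k k.
Proof.
have h5 : (2 : int)%:~R = 2 :> algC by rewrite rmorph_nat.
apply: (@intr_inj algC); move: (2 : int) h5 => c h5.
rewrite !(intrD, intrM) !NE !EE h5.
have [] := coef_rank1 i k; rewrite !expr2.
move: ((15 + r) * coef j1 i k) ((15 - r) * coef j2 i k) => a b.
move: (_ * coef j1 i i) (_ * coef j1 k k) => a1 a2.
move: (_ * coef j2 i i) (_ * coef j2 k k) => b1 b2 h1 h2.
ring: h1 h2.
Qed.

(* Twice the [i]-th diagonal entry of the part of [A] on its eigenvalue 16 is
   [4 - N i i - E i i]. *)
Lemma irrpart_diag_le4 i : (A *m A) i i = 74 -> A i i = 5 -> N i i + E i i <= 4.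
Proof.
move=> A2 A1; rewrite -subr_ge0.
(* This combination has eigenvalue [16 * 2 = 32] on the eigenvalue 16 of [A], and 0 elsewhere. *)
have -> : 4 - (N i i + E i i) = (A *m A - 14 *: A - N *m N + 14 *: N) i i.
  rewrite /E; move: (A *m A) (N *m N) A2 => AA NN; rewrite !mxE A1 => ->; ring.
rewrite -(ler0z algC).
set X := _ + 14 *: N; have -> : (X i i)%:~R = toC X i i by rewrite [RHS]mxE.
rewrite /X !(map_mxD, map_mxN, map_mxZ) A_spec2 N_spec2 AP NP.
rewrite -!scaleNr -!scaleN1r !(spec_mxZ, spec_mxD).
apply: spec_mx_ge0 => j; case: eigP; rewrite -/r !rmorph_nat.
all: by [rewrite [X in 0 <= X](_ : _ = 0); last by ring
  | rewrite [X in 0 <= X](_ : _ = 32%:R) ?ler0n //; ring].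
Qed.

(* Twice the [i]-th diagonal entry of the part of [A] on its eigenvalue 14 is
   [E i i - N i i + 6]. *)
Lemma irrpart_diag_ge i : (A *m A) i i = 74 -> A i i = 5 -> N i i - 6 <= E i i.
Proof.
move=> A2 A1; rewrite -subr_ge0.
(* This combination has eigenvalue [14 * 2 = 28] on the eigenvalue 14 of [A], and 0 elsewhere. *)
have -> : E i i - (N i i - 6) = (N *m N - 16 *: N - A *m A + 16 *: A) i i.
  rewrite /E; move: (A *m A) (N *m N) A2 => AA NN; rewrite !mxE A1 => ->; ring.
rewrite -(ler0z algC).
set X := _ + 16 *: A; have -> : (X i i)%:~R = toC X i i by rewrite [RHS]mxE.
rewrite /X !(map_mxD, map_mxN, map_mxZ) A_spec2 N_spec2 AP NP.
rewrite -!scaleNr -!scaleN1r !(spec_mxZ, spec_mxD).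
apply: spec_mx_ge0 => j; case: eigP; rewrite -/r !rmorph_nat.
all: by [rewrite [X in 0 <= X](_ : _ = 0); last by ring
  | rewrite [X in 0 <= X](_ : _ = 28%:R) ?ler0n //; ring].
Qed.

Hypothesis n50 : n = 50%N.
Hypothesis A_odd : forall i j, ~~ (2 %| A i j)%Z.

(* As [A] is odd, every column of [N *m N = N *m A] is congruent mod 2 to the vector
   of row sums of [N]; one of these columns vanishes since [\tr N < n]. *)
Lemma irrpart_diag_even i : (2 %| E i i - N i i)%Z.
Proof.
have [k /eqP k0] : exists k, N k k == 0.
  apply/existsP; apply: contraT; rewrite negb_exists => /forallP h.
  suff : 50%:R <= \tr N by rewrite irrpart_trace.
  have <- : \sum_(i < n) (1 : int) = 50%:R by rewrite sumr_const card_ord n50.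
  apply: ler_sum => j _; rewrite -gtz0_ge1 lt0r irrpart_diag_ge0 andbT; apply: h.
have Ek : E k k = 0.
  have := irrpart_diag_det k; rewrite k0 expr0n mulr0 => h.
  by apply/eqP; rewrite -sqrf_eq0 eq_le h sqr_ge0.
(* With [N k k = E k k = 0], the sum of squares [5 * N j k ^+ 2 + E j k ^+ 2] vanishes. *)
have Nk j : N j k = 0.
  have := irrpart_sqr j k; rewrite k0 Ek !mulr0 addr0 => h.
  by apply/eqP; rewrite -sqrf_eq0; move: (sqr_ge0 (N j k)) (sqr_ge0 (E j k)); lia.
have mod2 j l : (2 %| (N *m N) j l - \sum_m N j m)%Z.
  rewrite -irrpart_mul_gram mxE -sumrB; apply: rpred_sum => m _.
  rewrite -[X in _ - X]mulr1 -mulrBr; apply: dvdz_mull.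
  by move: (A m l) (A_odd m l) => a; lia.
have even_row j : (2 %| \sum_m N j m)%Z.
  have := mod2 j k; rewrite mxE big1 => [|m _]; last by rewrite Nk mulr0.
  by rewrite sub0r rpredN.
have := rpredD (mod2 i i) (even_row i); rewrite subrK => h.
have -> : E i i = (N *m N) i i - 15 * N i i by rewrite /E [LHS]mxE !mxE.
have -> : (N *m N) i i - 15 * N i i - N i i = (N *m N) i i - 2 * (8 * N i i) by ring.
by rewrite rpredB // dvdz_mulr.
Qed.
End IrrationalPart.

(** * Contradiction from the trace of [E] *)

Theorem theorem5p6 :
  ~ exists (n : nat) (S : 'M[int]_n),
      is_seidel S /\
      char_poly S =
        ('X + 5%:P) ^+ 33 * ('X - 9%:P) ^+ 10 * ('X - 11%:P) ^+ 5
          * ('X^2 - 20%:P * 'X + 95%:P).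
Proof.
move=> [n [S [[symS diagS offS] chiS]]].
have [n50 [P [d [j1 [j2 [uP AP [j12 d1 d2] d0]]]]]] := gram_spectrum symS chiS.
set A := S + 5%:M in AP.
have symA : A^T = A by rewrite linearD /= tr_scalar_mx symS.
have A1 i : A i i = 5 by rewrite !mxE diagS eqxx.
have A_off i j : i != j -> A i j = 1 \/ A i j = -1.
  by move=> ij; rewrite !mxE (negPf ij) mulr0n addr0; apply: offS.
have A_odd i j : ~~ (2 %| A i j)%Z.
  case: (eqVneq i j) => [-> | /A_off[->|->]] //; by rewrite A1.
(* The squared norm of a row of [A] is [25 + 49]. *)
have A2 i : (A *m A) i i = 74.
  rewrite sym_mulmx_diag // (bigD1 i) //= A1 (eq_bigr (fun=> 1)) => [|k ki].
    by rewrite sumr_const cardC1 card_ord n50.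
  by rewrite eq_sym in ki; case: (A_off _ _ ki) => ->.
have [N NA] := gram_cubic_dvd4 n50 symA A1 A_odd.
have tE := irrpart_trace2 uP AP j12 d1 d2 d0 NA.
suff : \tr (N *m N - 15 *: N) <= 0 by rewrite tE.
apply: sumr_le0 => i _; apply: shifted_diag_le0 => {i}.
- exact: irrpart_sym symA NA.
- exact: irrpart_cubic uP AP d1 d2 d0 NA.
- by move=> i k; apply: irrpart_sqr symA uP AP j12 d1 d2 d0 NA i k.
- by move=> i k; apply: irrpart_mul symA uP AP j12 d1 d2 d0 NA i k.
- by move=> i; apply: irrpart_diag_ge0 uP AP j12 d1 d2 d0 NA i.
- by move=> i; apply: irrpart_diag_det uP AP j12 d1 d2 d0 NA i.
- by move=> i; apply: irrpart_diag_le4 uP AP d1 d2 d0 NA _ (A2 i) (A1 i).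
- by move=> i; apply: irrpart_diag_ge uP AP d1 d2 d0 NA _ (A2 i) (A1 i).
by move=> i; apply: irrpart_diag_even symA uP AP j12 d1 d2 d0 NA n50 A_odd i.
Qed.
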